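(* Let $M$ be a lattice of rank $d$ and let $P\subset M_{\mathbb{R}}$ be a smooth and $G$-flat $d$-dimensional lattice polytope. Then $\mathcal{N}_0(\omega_P)=\mathcal{N}_p(\omega_P)$ for every prime $p$.
   Context: $M$ is a free abelian group of rank $d$, $M_{\mathbb{R}}=M\otimes_{\mathbb{Z}}\mathbb{R}$. A lattice polytope in $M_{\mathbb{R}}$ is a convex polytope whose vertices all lie in $M$. For such $P$ let $\omega_P=\operatorname{Cone}\{(x,1)\mid x\in P\}\subset M_{\mathbb{R}}\times\mathbb{R}$, considered with the lattice $M\times\mathbb{Z}$, and let $G(\omega_P)$ be its Hilbert basis, i.e. the minimal generating set of the semigroup $\omega_P\cap(M\times\mathbb{Z})$. $P$ is $G$-flat if $G(\omega_P)$ is contained in the hyperplane $\{(x,1)\mid x\in M_{\mathbb{R}}\}$. A full-dimensional lattice polytope $P$ is smooth if its normal fan is regular, i.e. for every vertex $v$ of $P$ the feasible cone $\operatorname{fcone}(P,v)=\operatorname{Cone}\{x-v\mid x\in P\}$ is regular (generated by a part of a $\mathbb{Z}$-basis of $M$). For $h_1,\dots,h_{d+1}\in M\times\mathbb{Z}$ let $\det_0(h_1\cdots h_{d+1})$ be the determinant of the matrix with columns $h_i$ (with respect to a fixed $\mathbb{Z}$-basis), and for $p$ prime let $\det_p$ be this determinant modulo $p$. For $p=0$ or $p$ prime, $$\mathcal{N}_p(\omega_P)=\operatorname{Conv}\big\{(h_1+\dots+h_{d+1})+\omega_P\mid h_i\in G(\omega_P)\text{ and }\det_p(h_1\cdots h_{d+1})\neq0\big\},$$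 the convex hull of the union of these translates of $\omega_P$. *)

(* Defs.v *)
From HB Require Import structures.
From mathcomp Require Import all_boot all_order all_algebra.
From mathcomp Require Import boolp classical_sets cardinality reals.
From mathcomp Require Import convex.

Set Implicit Arguments.
Unset Strict Implicit.
Unset Printing Implicit Defensive.

Import Order.TTheory GRing.Theory Num.Theory.

Local Open Scope classical_set_scope.
Local Open Scope ring_scope.

(* A lattice of rank n is taken with a fixed Z-basis, i.e. as 'cV[int]_n inside
   the real space 'cV[R]_n; the rank-(d + 1) lattice M x Z is 'cV[int]_(d + 1),
   whose last coordinate is the Z factor. *)
Definition lat (R : realType) n (m : 'cV[int]_n) : 'cV[R]_n := map_mx intr m.
Arguments lat R {n} m.

Definition conv (R : realType) n (X : set 'cV[R]_n) : set 'cV[R]_n :=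
  smallest (fun A : set 'cV[R]_n => convex_set A) X.

Definition affine_set (R : realType) n (A : set 'cV[R]_n) : Prop :=
  forall (x y : 'cV[R]_n) (t : R), A x -> A y -> A (t *: x + (1 - t) *: y).

Definition aff (R : realType) n (X : set 'cV[R]_n) : set 'cV[R]_n :=
  smallest (@affine_set R n) X.

Definition convex_cone (R : realType) n (C : set 'cV[R]_n) : Prop :=
  [/\ C 0,
      forall x y : 'cV[R]_n, C x -> C y -> C (x + y) &
      forall (t : R) (x : 'cV[R]_n), 0 <= t -> C x -> C (t *: x)].

Definition cone (R : realType) n (X : set 'cV[R]_n) : set 'cV[R]_n :=
  smallest (@convex_cone R n) X.

Definition polytope (R : realType) n (P : set 'cV[R]_n) : Prop :=
  exists V : set 'cV[R]_n, finite_set V /\ P = conv V.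

(* {v} is the face of P on which the linear form u is minimal *)
Definition vertex (R : realType) n (P : set 'cV[R]_n) (v : 'cV[R]_n) : Prop :=
  P v /\ exists u : 'rV[R]_n,
    forall x, P x -> x <> v -> (u *m v) 0 0 < (u *m x) 0 0.

Definition lattice_polytope (R : realType) n (P : set 'cV[R]_n) : Prop :=
  polytope P /\ forall v, vertex P v -> range (lat R) v.

Definition full_dimensional (R : realType) n (P : set 'cV[R]_n) : Prop :=
  aff P = setT.

(* the columns of B \in unitmx form a Z-basis of the lattice *)
Definition regular_cone (R : realType) n (C : set 'cV[R]_n) : Prop :=
  exists2 B : 'M[int]_n, B \in unitmx &
    exists I : {set 'I_n}, C = cone [set lat R (col i B) | i in [set` I]].

Definition fcone (R : realType) n (P : set 'cV[R]_n) (v : 'cV[R]_n) :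
  set 'cV[R]_n := cone [set x - v | x in P].

Definition smooth (R : realType) n (P : set 'cV[R]_n) : Prop :=
  forall v, vertex P v -> regular_cone (fcone P v).

(* The semigroups C `&` M contain 0, which is generated by the empty set. *)
Definition submonoid n (A : set 'cV[int]_n) : Prop :=
  A 0 /\ forall x y : 'cV[int]_n, A x -> A y -> A (x + y).

Definition generates n (G S : set 'cV[int]_n) : Prop :=
  smallest (@submonoid n) G = S.

Definition minimal_generating_set n (S G : set 'cV[int]_n) : Prop :=
  generates G S /\ forall G', generates G' S -> G' `<=` G -> G' = G.

(* The default set0 is only reached for cones without a minimal generating set;
   for pointed rational cones that set exists and is unique. *)
Definition hilbert_basis (R : realType) n (C : set 'cV[R]_n) :
  set 'cV[int]_n := xget set0 (minimal_generating_set (lat R @^-1` C)).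

Definition height1 (R : realType) n (x : 'cV[R]_n) : 'cV[R]_(n + 1) :=
  col_mx x 1%:M.

Definition omega (R : realType) n (P : set 'cV[R]_n) : set 'cV[R]_(n + 1) :=
  cone [set height1 x | x in P].

Definition G_flat (R : realType) n (P : set 'cV[R]_n) : Prop :=
  lat R @` hilbert_basis (omega P) `<=` range (@height1 R n).

(* As m %% 0 = m, this is the determinant itself for p = 0, and the
   representative of its residue class in [0, p) for p > 0. *)
Definition det_mod n (p : nat) (h : 'I_n -> 'cV[int]_n) : int :=
  (\det (\matrix_(i, j) h j i 0)%R %% p)%Z.

Definition newton (R : realType) n (p : nat) (C : set 'cV[R]_n) :
  set 'cV[R]_n :=
  conv (\bigcup_(h in [set h : 'I_n -> 'cV[int]_n |
                        (forall i, hilbert_basis C (h i)) /\ det_mod p h <> 0])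
          [set lat R (\sum_i h i) + y | y in C]).

(* Main.v *)
(* Let [v] be a vertex of [P], with edge directions [e_i] forming a basis of the
   lattice.  The points [v + e_i] lie in [P], so [(v, 1)] and the [(v + e_i, 1)]
   form a unimodular subset of the Hilbert basis, whose determinant is nonzero
   modulo every prime; let [b_v] be their sum.  If [h] is any basis of rational
   space made of lattice points [v + \sum_i a_ij e_i] of [P] at height one, then a
   nonvanishing term of its determinant gives [\sum_j a_ij >= 1] for all [i], so
   that [u b_v <= u (\sum_j h_j)] whenever the linear form [u] is minimal on [P]
   at [v].  As each linear form is minimal at some vertex, [\sum_j h_j] is in the
   convex hull of the [b_v] by the Farkas lemma. *)
Require Import Defs.
From mathcomp Require Import all_boot all_order all_algebra.
From mathcomp Require Import boolp classical_sets reals.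
From mathcomp Require Import cardinality interval_inference.
From mathcomp Require convex.
From mathcomp Require Import ring lra zify.

Set Implicit Arguments.
Unset Strict Implicit.
Unset Printing Implicit Defensive.

Import Order.TTheory GRing.Theory Num.Theory.

Local Open Scope classical_set_scope.
Local Open Scope ring_scope.

Local Notation convex_set := convex.convex_set.

(** * Linear forms, convex cones and the Farkas lemma *)

Section Convexity.
Context (R : realType).

Definition lform n (u : 'rV[R]_n) (x : 'cV[R]_n) : R := (u *m x) 0 0.

Lemma lformD n (u : 'rV[R]_n) x y : lform u (x + y) = lform u x + lform u y.
Proof. by rewrite /lform mulmxDr mxE. Qed.

Lemma lformZ n (u : 'rV[R]_n) t x : lform u (t *: x) = t * lform u x.
Proof. by rewrite /lform -scalemxAr mxE. Qed.

Lemma lformB n (u : 'rV[R]_n) x y : lform u (x - y) = lform u x - lform u y.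
Proof. by rewrite /lform mulmxBr !mxE. Qed.

Lemma lform0 n (u : 'rV[R]_n) : lform u 0 = 0.
Proof. by rewrite /lform mulmx0 mxE. Qed.

Lemma lformDl n (u w : 'rV[R]_n) x : lform (u + w) x = lform u x + lform w x.
Proof. by rewrite /lform mulmxDl mxE. Qed.

Lemma lformZl n t (u : 'rV[R]_n) x : lform (t *: u) x = t * lform u x.
Proof. by rewrite /lform -scalemxAl mxE. Qed.

Lemma convex_setP n (A : set 'cV[R]_n) :
  convex_set A <-> forall x y t, 0 <= t -> t <= 1 -> A x -> A y ->
    A (t *: x + (1 - t) *: y).
Proof.
split=> [cA x y t t0 t1 Ax Ay|cA x y t].
  have := cA x y (Itv01 t0 t1); rewrite !inE; exact.
by rewrite !inE => Ax Ay; apply: cA.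
Qed.

Lemma conv_convex n (X : set 'cV[R]_n) : convex_set (conv X).
Proof.
apply/convex_setP => x y t t0 t1 cx cy A [cA XA].
by move/convex_setP: (cA); apply => //; [apply: cx|apply: cy].
Qed.

Lemma cone_convex_cone n (X : set 'cV[R]_n) : convex_cone (cone X).
Proof.
split=> [A [[]]//|x y cx cy A cA|t x t0 cx A cA].
  by case: (cA) => -[_ + _] _; apply; [apply: cx|apply: cy].
by case: (cA) => -[_ _ +] _; apply => //; apply: cx.
Qed.

Lemma convex_lform_ge n (u : 'rV[R]_n) c :
  convex_set [set x : 'cV[R]_n | c <= lform u x].
Proof. by apply/convex_setP => x y t t0 t1 /= hx hy; rewrite lformD !lformZ; nra. Qed.

Lemma convex_cone_lform_ge0 n (u : 'rV[R]_n) :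
  convex_cone [set x : 'cV[R]_n | 0 <= lform u x].
Proof.
split => [|x y|t x] /=; first by rewrite lform0.
  by rewrite lformD; apply: addr_ge0.
by rewrite lformZ; apply: mulr_ge0.
Qed.

Lemma conv_lform_ge n (u : 'rV[R]_n) c (X : set 'cV[R]_n) :
  (forall x, X x -> c <= lform u x) -> forall x, conv X x -> c <= lform u x.
Proof. by move=> Xc; apply: smallest_sub (@convex_lform_ge _ _ _) Xc. Qed.

Lemma cone_lform_ge0 n (u : 'rV[R]_n) (X : set 'cV[R]_n) :
  (forall x, X x -> 0 <= lform u x) -> forall x, cone X x -> 0 <= lform u x.
Proof. by move=> Xu; apply: (smallest_sub (@convex_cone_lform_ge0 _ u) Xu). Qed.

(* Bartl's inductive proof of the Farkas lemma: a form [u0] that violates the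
   claim for [bs] is negative at the remaining generator [a], and projecting
   along [a] onto the kernel of [u0] removes [a] from the list. *)
Lemma farkas n (bs : seq 'cV[R]_n) (s : 'cV[R]_n) :
  (forall u, (forall b, b \in bs -> 0 <= lform u b) -> 0 <= lform u s) ->
  cone [set` bs] s.
Proof.
move Em: (size bs) => m; elim: m bs s Em => [|m IH] [|a bs] s //= => [_|[sz]] H.
  suff -> : s = 0 by case: (cone_convex_cone [set` [::] : seq 'cV[R]_n]).
  apply/matrixP => i j; rewrite ord1 mxE.
  have lfd t : lform (t *: delta_mx 0 i) s = t * s i 0.
    rewrite lformZl /lform mxE (bigD1 i) //= big1 ?addr0 => [|k /negPf ki].
      by rewrite mxE !eqxx mul1r.
    by rewrite mxE ki andbF mul0r.
  have h1 : 0 <= 1 * s i 0 by rewrite -lfd; apply: H.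
  have h2 : 0 <= (-1) * s i 0 by rewrite -lfd; apply: H.
  lra.
have [C0 CD CZ] := cone_convex_cone [set` a :: bs].
have Cg b : b \in a :: bs -> cone [set` a :: bs] b.
  by move=> bV; apply: sub_gen_smallest.
have [Hs|/existsNP[u0 /not_implyP[u0bs u0s]]] :=
    pselect (forall u, (forall b, b \in bs -> 0 <= lform u b) -> 0 <= lform u s).
  apply: (smallest_sub _ _ (IH _ _ sz Hs)); first exact: cone_convex_cone.
  by move=> b /= bbs; apply: Cg; rewrite inE bbs orbT.
have {}u0s : lform u0 s < 0 by rewrite ltNge; apply/negP.
wlog u0a : u0 u0bs u0s / lform u0 a = -1 => [W|].
  have u0a : lform u0 a < 0.
    rewrite ltNge; apply/negP => u0a; suff : 0 <= lform u0 s by rewrite leNgt u0s.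
    apply: H => b.
    by rewrite inE => /predU1P[->//|]; apply: u0bs.
  have k0 : 0 < (- lform u0 a)^-1 by rewrite invr_gt0; lra.
  apply: (W ((- lform u0 a)^-1 *: u0)) => [b /u0bs||].
  - by rewrite lformZl => ?; apply: mulr_ge0 => //; apply: ltW.
  - by rewrite lformZl pmulr_rlt0.
  - by rewrite lformZl invrN mulNr mulVf ?lt_eqF.
pose f x := x + lform u0 x *: a.
have Cfs : cone [set` map f bs] (f s).
  apply: IH => [|u Hu]; first by rewrite size_map.
  (* The form on the right vanishes at [a], since [u0] is -1 there; so it meets the condition in [H]
     as soon as [u] is nonnegative on the projected generators. *)
  have uf x : lform u (f x) = lform (u + lform u a *: u0) x.
    by rewrite /f lformD lformZ lformDl lformZl mulrC.
  rewrite uf; apply: H => b; rewrite inE => /predU1P[->|bbs].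
    by rewrite lformDl lformZl u0a; lra.
  by rewrite -uf; apply/Hu/map_f.
have -> : s = f s + (- lform u0 s) *: a by rewrite /f scaleNr addrK.
apply: (CD); last by apply: (CZ); [lra|apply: Cg; rewrite mem_head].
apply: (smallest_sub (cone_convex_cone _) _ Cfs).
move=> _ /= /mapP[b bbs ->]; rewrite /f; apply: CD.
  by apply: Cg; rewrite inE bbs orbT.
by apply: CZ; [exact: u0bs|apply: Cg; rewrite mem_head].
Qed.

(** The positive multiples of the points [height1 x] with [x] in [A], together with 0, already form
    a convex cone; comparing last coordinates forces the multiple to be 1. *)
Lemma cone_height1 n (A : set 'cV[R]_n) s :
  convex_set A -> cone [set height1 x | x in A] (height1 s) -> A s.
Proof.
move=> /convex_setP cA.
pose K := [set y | y = 0 \/ exists t x, [/\ 0 < t, A x & y = t *: height1 x]].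
have KK : convex_cone K.
  split; first by left.
  - move=> _ _ [->|[t [x [t0 Ax ->]]]] [->|[t' [x' [t0' Ax' ->]]]].
    + by rewrite add0r; left.
    + by rewrite add0r; right; exists t', x'.
    + by rewrite addr0; right; exists t, x.
    right; exists (t + t'), ((t / (t + t')) *: x + (1 - t / (t + t')) *: x').
    split; first lra.
    + apply: cA => //; first by rewrite divr_ge0; lra.
      by rewrite ler_pdivrMr; lra.
    rewrite /height1 !scale_col_mx add_col_mx; congr col_mx.
      rewrite scalerDr !scalerA; congr (_ *: _ + _ *: _); field; lra.
    by rewrite -scalerDl.
  - move=> t _ t0 [->|[t' [x [t0' Ax ->]]]]; first by rewrite scaler0; left.
    move: t0; rewrite le_eqVlt => /predU1P[<-|t0]; first by rewrite scale0r; left.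
    by right; exists (t * t'), x; rewrite scalerA mulr_gt0.
have AK : [set height1 x | x in A] `<=` K.
  by move=> _ [x Ax <-]; right; exists 1, x; rewrite scale1r.
move=> /(smallest_sub KK AK)[/eqP|[t [x [_ Ax]]]].
  rewrite /height1 -col_mx0 => /eqP/eq_col_mx[_ /matrixP/(_ 0 0)/eqP].
  by rewrite !mxE oner_eq0.
rewrite /height1 scale_col_mx => /eq_col_mx[-> /matrixP/(_ 0 0)].
by rewrite !mxE mulr1 => <-; rewrite scale1r.
Qed.

(** Lifting to height one makes affine inequalities linear, so the Farkas lemma applies: a form that
    is nonnegative on all lifted [b] takes at the lifted [s] a value at least as large as at one of
    them. *)
Lemma mem_convex_set n (A : set 'cV[R]_n) (bs : seq 'cV[R]_n) s :
  convex_set A -> [set` bs] `<=` A ->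
  (forall u, exists2 b, b \in bs & lform u b <= lform u s) -> A s.
Proof.
move=> cA bsA H; apply: cone_height1 => //.
have lh (u : 'rV[R]_(n + 1)) x :
    lform u (height1 x) = lform (lsubmx u) x + rsubmx u 0 0.
  by rewrite /height1 /lform -{1}[u]hsubmxK mul_row_col mulmx1 mxE.
apply: smallest_sub (farkas (bs := map (@height1 R n) bs) _).
- exact: cone_convex_cone.
- by move=> _ /= /mapP[x xbs ->]; apply: sub_gen_smallest; exists x => //; apply: bsA.
move=> u Hu; have [b bbs ub] := H (lsubmx u).
by rewrite lh; apply: le_trans (Hu _ (map_f _ bbs)) _; rewrite lh lerD2r.
Qed.

(** * Vertices as minimizers of linear forms *)

Lemma seq_argmin (T : eqType) (f : T -> R) (s : seq T) x0 :
  x0 \in s -> exists2 m, m \in s & forall x, x \in s -> f m <= f x.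
Proof.
elim: s x0 => // a s IH x0 _; case: s IH => [_|b s /(_ b)].
  by exists a; rewrite ?mem_head// => x; rewrite inE => /eqP->.
rewrite mem_head => -[//|m ms Hm]; case: (leP (f a) (f m)) => am.
  exists a; rewrite ?mem_head// => x; rewrite inE => /predU1P[->//|/Hm].
  exact: le_trans.
exists m => [|x]; first by rewrite inE ms orbT.
by rewrite inE => /predU1P[->|/Hm//]; apply: ltW.
Qed.

(** Replaces lexicographic positivity of the pair [(f, g)] on a finite list by positivity of one
    combination. *)
Lemma perturb_gt0 (T : eqType) (f g : T -> R) (s : seq T) :
  (forall x, x \in s -> 0 <= f x /\ (f x = 0 -> 0 < g x)) ->
  exists2 e, 0 < e & forall x, x \in s -> 0 < f x + e * g x.
Proof.
elim: s => [|a s IH] H; first by exists 1.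
have [|e e0 He] := IH; first by move=> x xs; apply: H; rewrite inE xs orbT.
have [fa ga] := H a (mem_head _ _).
(* For negative [g a] the second bound keeps [f a + e' * g a] at least [f a / 2]. Shrinking [e] is
   harmless at the other points: there [f] is nonnegative, and [g] is positive where [f]
   vanishes. *)
pose e' := if 0 <= g a then e else Num.min e (f a / (2 * - g a)).
have e'0 : 0 < e' /\ e' <= e /\ 0 < f a + e' * g a.
  rewrite /e'; case: (leP 0 (g a)) => g0.
    split => //; split => //; have [/ga|] := eqVneq (f a) 0; first by nra.
    by move=> fa0; rewrite ltr_pwDl ?lt_def ?fa0// mulr_ge0// ltW.
  have fa0 : 0 < f a by rewrite lt_def fa andbT; apply/eqP => /ga; lra.
  have q0 : 0 < f a / (2 * - g a) by rewrite divr_gt0//; lra.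
  split; first by rewrite lt_min e0.
  split; first by rewrite ge_min lexx.
  have : Num.min e (f a / (2 * - g a)) <= f a / (2 * - g a).
    by rewrite ge_min lexx orbT.
  by rewrite ler_pdivlMr; lra.
case: e'0 => e'0 [e'e Ha]; exists e' => // x; rewrite inE => /predU1P[->//|xs].
have xas : x \in a :: s by rewrite inE xs orbT.
have := He x xs; have [fx fx0g] := H x xas.
have [gx|gx] := leP 0 (g x); last by nra.
have [fx0|fx0] := eqVneq (f x) 0; last first.
  have : 0 < f x by rewrite lt_def fx0.
  by nra.
have gx0 := fx0g fx0.
by rewrite fx0 !add0r; nra.
Qed.

(** A single form has to expose [w]: [u1 + e *: u2] with a small positive [e] does, as [u2] only
    breaks the ties of [u1]. *)
Lemma vertex_lexmin n (V : seq 'cV[R]_n) w (u1 u2 : 'rV[R]_n) :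
  w \in V -> (forall x, x \in V -> lform u1 w <= lform u1 x) ->
  (forall x, x \in V -> x != w -> lform u1 x = lform u1 w ->
     lform u2 w < lform u2 x) ->
  vertex (conv [set` V]) w.
Proof.
move=> wV H1 H2; split; first exact: sub_gen_smallest.
have [|e e0 He] := @perturb_gt0 _ (fun x => lform u1 (x - w))
    (fun x => lform u2 (x - w)) [seq x <- V | x != w].
  move=> x; rewrite mem_filter => /andP[xw xV]; rewrite !lformB !subr_ge0 subr_gt0.
  by split=> [|/subr0_eq]; [apply: H1|apply: H2].
exists (u1 + e *: u2); pose u := u1 + e *: u2; rewrite -/u.
suff S : conv [set` V] `<=` [set x | x = w \/ lform u w < lform u x].
  by move=> x /S[].
apply: smallest_sub => [|x /= xV].
  apply/convex_setP => x y t t0 t1 /= xw yw.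
  have [t1E|t1E] := eqVneq t 1; first by rewrite t1E subrr scale0r scale1r addr0.
  have {t1E}t1 : t < 1 by rewrite lt_def eq_sym t1E.
  have [t0E|t0E] := eqVneq t 0; first by rewrite t0E subr0 scale0r scale1r add0r.
  have {t0E}t0 : 0 < t by rewrite lt_def t0E.
  case: xw yw => [->|xw] [->|yw].
  - by left; rewrite -scalerDl addrC subrK scale1r.
  - by right; rewrite lformD !lformZ; nra.
  - by right; rewrite lformD !lformZ; nra.
  - by right; rewrite lformD !lformZ; nra.
have [->|xw] := eqVneq x w; [by left|right].
have := He x; rewrite mem_filter xw xV => /(_ isT).
by rewrite -lformZl -lformDl lformB subr_gt0.
Qed.

(* Among the minimizers of [u] in [V], a point of largest Euclidean norm is
   exposed. *)
Lemma vertex_minimizer n (V : seq 'cV[R]_n) x0 (u : 'rV[R]_n) :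
  x0 \in V -> exists v, vertex (conv [set` V]) v /\
    forall x, conv [set` V] x -> lform u v <= lform u x.
Proof.
move=> x0V; have [m mV Hm] := seq_argmin (lform u) x0V.
have mF : m \in [seq x <- V | lform u x == lform u m] by rewrite mem_filter eqxx.
have [w] := seq_argmin (fun x => - lform x^T x) mF.
rewrite mem_filter => /andP[/eqP uw wV] Hw.
have Hu x : x \in V -> lform u w <= lform u x by rewrite uw; apply: Hm.
exists w; split; last exact: conv_lform_ge.
apply: (vertex_lexmin (u1 := u) (u2 := - w^T)) => // x xV xw uxw.
have : lform x^T x <= lform w^T w.
  by rewrite -lerN2; apply: Hw; rewrite mem_filter uxw uw eqxx.
have lfE (a b : 'cV[R]_n) : lform a^T b = \sum_i a i 0 * b i 0.
  by rewrite /lform mxE; apply: eq_bigr => i _; rewrite mxE.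
(* As the norm of [x] is at most that of [w], expanding this square puts [lform w^T x] strictly
   below [lform w^T w]. *)
have : 0 < lform (x - w)^T (x - w).
  rewrite lfE lt_def sumr_ge0 ?andbT => [|i _]; last by rewrite -expr2 sqr_ge0.
  apply: contraNneq xw => /eqP; rewrite psumr_eq0 => [/allP H|i _]; last first.
    by rewrite -expr2 sqr_ge0.
  rewrite -subr_eq0; apply/eqP/matrixP => i j; rewrite ord1 [RHS]mxE; apply/eqP.
  by have := H i (mem_index_enum _); rewrite /= mulf_eq0 orbb.
have -> : lform (x - w)^T (x - w) = lform x^T x + lform w^T w - 2 * lform w^T x.
  rewrite !lfE mulr_sumr -big_split -sumrB; apply: eq_bigr => i _.
  by rewrite !mxE /=; ring.
by rewrite -scaleN1r !lformZl; lra.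
Qed.

Lemma vertex_mem n (V : seq 'cV[R]_n) v : vertex (conv [set` V]) v -> v \in V.
Proof.
case=> cv [u Hu]; apply: contrapT => vV.
suff : conv [set` V] `<=` [set x | lform u v < lform u x].
  by move/(_ _ cv); rewrite /= ltxx.
apply: smallest_sub => [|x /= xV].
  apply/convex_setP => x y t t0 t1 /= hx hy; rewrite lformD !lformZ.
  have [->|tn0] := eqVneq t 0; first lra.
  have {}t0 : 0 < t by rewrite lt_def tn0.
  by nra.
by apply: Hu; [exact: sub_gen_smallest|move=> xv; apply: vV; rewrite -xv].
Qed.

End Convexity.

(** * Lattice vectors and the edges of a smooth polytope at a vertex *)

Section Lattice.
Context (R : realType).

Lemma lat_inj n : injective (@lat R n).
Proof.
move=> x y /matrixP xy; apply/matrixP => i j; have := xy i j.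
by rewrite !mxE; apply: intr_inj.
Qed.

Lemma latD n (x y : 'cV[int]_n) : lat R (x + y) = lat R x + lat R y.
Proof. exact: map_mxD. Qed.

Lemma latB n (x y : 'cV[int]_n) : lat R (x - y) = lat R x - lat R y.
Proof. exact: map_mxB. Qed.

Lemma lat_mulmx m n (A : 'M[int]_(m, n)) x :
  lat R (A *m x) = map_mx intr A *m lat R x.
Proof. exact: map_mxM. Qed.

Lemma lform_row m n (A : 'M[R]_(m, n)) i x : lform (row i A) x = (A *m x) i 0.
Proof. by rewrite /lform -row_mul mxE. Qed.

Lemma mulmxE_lat n (B : 'M[int]_n) (y : 'cV[int]_n) :
  lat R (B *m y) = \sum_i (y i 0)%:~R *: lat R (col i B).
Proof.
apply/matrixP => k j; rewrite ord1 summxE !mxE rmorph_sum; apply: eq_bigr => i _.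
by rewrite !mxE rmorphM mulrC.
Qed.

(** The edge leaving the vertex in direction [col i B] ends at another lattice vertex, which lies at
    a positive integral multiple of this direction; by convexity the first lattice point on the edge
    is in [P]. *)
Lemma smooth_vertex d (P : set 'cV[R]_d) v0 :
  lattice_polytope P -> full_dimensional P -> smooth P -> vertex P (lat R v0) ->
  exists2 B : 'M[int]_d, B \in unitmx &
    (forall x, P x -> forall i, 0 <= (map_mx intr (invmx B) *m (x - lat R v0)) i 0) /\
    (forall i, P (lat R v0 + lat R (col i B))).
Proof.
move=> [[_ [/finite_seqP[V ->] PV]] Pl] Pf Ps Pv.
have [B Bu [I fI]] := Ps _ Pv; exists B => //.
set v := lat R v0 in Pv fI *; set D := map_mx intr (invmx B).
have Db i j : (D *m lat R (col i B)) j 0 = (j == i)%:R.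
  by rewrite -lat_mulmx colE mulKmx // !mxE eqxx andbT natz.
have fcP x : P x -> fcone P v (x - v).
  by move=> Px; apply: sub_gen_smallest; exists x.
have fge x i : fcone P v x -> 0 <= (D *m x) i 0.
  rewrite -lform_row fI; apply: cone_lform_ge0.
  by move=> _ [j _ <-] /=; rewrite lform_row Db ler0n.
have feq x i : i \notin I -> fcone P v x -> (D *m x) i 0 <= 0.
  move=> iI; rewrite -oppr_ge0 -lform_row -[- _]mulN1r -lformZl fI.
  apply: cone_lform_ge0.
  move=> _ [j jI <-] /=; rewrite lformZl lform_row Db; case: eqP => [ij|_].
    by rewrite ij jI in iI.
  by rewrite mulr0.
(* An index missing from [I] would put [P] in a hyperplane through [v], against full dimension. *)
have IT i : i \in I.
  apply: contrapT => /negP iI.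
  have : aff P `<=` [set x | (D *m (x - v)) i 0 = 0].
    apply: smallest_sub => [x y t /= xv yv|x Px].
      have -> : t *: x + (1 - t) *: y - v = t *: (x - v) + (1 - t) *: (y - v).
        rewrite !scalerBr addrACA -opprD -scalerDl.
        by rewrite [t + _]addrC subrK scale1r.
      rewrite -lform_row lformD !lformZ !lform_row xv yv; lra.
    by apply/eqP; rewrite eq_le feq ?fge //; apply: fcP.
  rewrite Pf => /(_ (v + lat R (col i B)) Logic.I) /=.
  by rewrite addrC addKr Db eqxx => /eqP; rewrite oner_eq0.
split=> [x Px i|i]; first by apply: fge; apply: fcP.
have Cb : fcone P v (lat R (col i B)).
  by rewrite fI; apply: sub_gen_smallest; exists i => //; apply: IT.
(* On [P] the value of [u1] at [x - v] is nonnegative and vanishes exactly along the [i]-th edge, on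
   which [u2] decreases away from [v]. *)
pose u1 := \sum_(j | j != i) row j D; pose u2 := - row i D.
have u1E x : lform u1 x = \sum_(j | j != i) (D *m x) j 0.
  rewrite /lform mulmx_suml summxE; apply: eq_bigr => j _; exact: lform_row.
have u2E x : lform u2 x = - (D *m x) i 0.
  by rewrite -lform_row /u2 -[- row i D]scaleN1r lformZl mulN1r.
have u1ge x : P x -> 0 <= lform u1 (x - v).
  by move=> Px; rewrite u1E sumr_ge0 // => j _; apply: fge; apply: fcP.
have u1eq x : P x -> lform u1 (x - v) = 0 ->
    x = v - lform u2 (x - v) *: lat R (col i B).
  move=> Px; rewrite u1E u2E scaleNr opprK => /eqP.
  rewrite psumr_eq0 => [/allP H|j _]; last by apply: fge; apply: fcP.
  apply/eqP; rewrite addrC -subr_eq; apply/eqP.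
  have Dinj : injective (mulmx D : 'cV[R]_d -> 'cV[R]_d).
    apply: (can_inj (g := mulmx (map_mx intr B))) => y.
    by rewrite mulmxA -map_mxM mulmxV // map_mx1 mul1mx.
  apply: Dinj; apply/matrixP => j k; rewrite ord1 -scalemxAr [RHS]mxE Db.
  have [->|ji] := eqVneq j i; first by rewrite mulr1.
  by rewrite mulr0; apply/eqP; have := H j (mem_index_enum _); rewrite ji.
have VP x : x \in V -> P x by move=> xV; rewrite PV; apply: sub_gen_smallest.
(* Otherwise some [u1 + e *: u2] with [e > 0] would be nonnegative on the feasible cone, although
   its value at [col i B] is [- e]. *)
have [x0 [x0V x0v x0u]] : exists x, [/\ x \in V, x != v & lform u1 (x - v) = 0].
  apply: contrapT => nx.
  have [|e e0 He] := @perturb_gt0 R _ (fun x => lform u1 (x - v))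
      (fun x => lform u2 (x - v)) [seq x <- V | x != v].
    move=> x; rewrite mem_filter => /andP[xv xV]; split; first exact/u1ge/VP.
    by move=> x0; case: nx; exists x.
  suff : 0 <= lform (u1 + e *: u2) (lat R (col i B)).
    rewrite lformDl lformZl u1E u2E Db eqxx big1 => [|j /negPf ji]; last first.
      by rewrite Db ji.
    by rewrite add0r mulrN1 oppr_ge0 leNgt e0.
  apply: cone_lform_ge0 Cb => _ [x Px <-].
  rewrite /= lformB subr_ge0; move: Px; rewrite PV; apply: conv_lform_ge => y yV.
  rewrite -subr_ge0 -lformB; have [->|yv] := eqVneq y v.
    by rewrite subrr lform0.
  by apply: ltW; rewrite lformDl lformZl; apply: He; rewrite mem_filter yv.
have x0F : x0 \in [seq x <- V | lform u1 (x - v) == 0].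
  by rewrite mem_filter x0u eqxx.
(* The far end of the edge: it minimizes [u1], then [u2], so it is a vertex and hence a lattice
   point. *)
have [w] := seq_argmin (lform u2) x0F.
rewrite mem_filter => /andP[/eqP wu wV] Hw.
have Pw := VP _ wV; have wE := u1eq _ Pw wu.
have [w0 _ wl] : range (lat R) w.
  apply: Pl; rewrite PV; apply: (vertex_lexmin (u1 := u1) (u2 := u2)) => // x xV.
    by have := u1ge _ (VP _ xV); move: wu; rewrite !lformB; lra.
  move=> xw xu.
  have xF : lform u1 (x - v) = 0 by rewrite lformB xu -lformB.
  rewrite lt_def Hw ?mem_filter ?xF ?eqxx // andbT.
  apply: contraNneq xw => xw; rewrite (u1eq _ (VP _ xV) xF) wE.
  by rewrite lformB xw -lformB -wE.
(* The length of the edge in units of [col i B], integral as a coordinate of a lattice vector in the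
   basis [B]. *)
have [k kE] : exists k : int, - lform u2 (w - v) = k%:~R.
  by exists ((invmx B *m (w0 - v0)) i 0); rewrite u2E opprK -wl -latB -lat_mulmx mxE.
have k0 : (0 < k)%R.
  rewrite -(ltr0z R) -kE.
  have : 0 < - lform u2 (x0 - v).
    rewrite lt_def {2}u2E opprK fge ?andbT; last by apply: fcP; apply: VP.
    apply: contraNneq x0v => /eqP; rewrite oppr_eq0 => /eqP x00.
    by rewrite (u1eq _ (VP _ x0V) x0u) x00 scale0r subr0.
  have := Hw _ x0F; rewrite !lformB; lra.
have k1 : 1 <= k%:~R :> R by rewrite -[1]/(1%:~R) ler_int.
rewrite -scaleNr kE in wE.
have -> : v + lat R (col i B) = k%:~R^-1 *: w + (1 - k%:~R^-1) *: v.
  rewrite {1}wE scalerDr scalerA mulVf ?scale1r; last by rewrite gt_eqF ?ltr0z.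
  by rewrite scalerBl scale1r addrAC [_ + (v - _)]addrC subrK.
have /convex_setP := @conv_convex R _ [set` V]; rewrite -PV; apply => //.
- by rewrite invr_ge0 ler0z ltW.
- by rewrite invf_le1 ?ltr0z.
- by case: Pv.
Qed.

(** * Height-one generators and unimodular systems *)

(** As generators have height one, a sum of two or more of them has height at least 2. *)
Lemma height1_generator n (G S : set 'cV[int]_(n + 1)) :
  generates G S -> (forall g, G g -> dsubmx g = 1%:M) ->
  forall h, S h -> dsubmx h = 1%:M -> G h.
Proof.
move=> <- G1 h Sh h1.
pose A := [set y : 'cV[int]_(n + 1) | [\/ y = 0, G y | 2 <= dsubmx y 0 0]].
have hge y : A y -> y = 0 \/ 1 <= dsubmx y 0 0.
  by case=> [->|/G1->|y2]; [left|right; rewrite mxE|right; apply: le_trans y2].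
suff /(_ _ Sh)[h0||] : smallest (@submonoid _) G `<=` A => //.
- by move: h1; rewrite h0 linear0 => /matrixP/(_ 0 0); rewrite !mxE.
- by rewrite h1 mxE.
apply: smallest_sub => [|g Gg]; last by constructor 2.
split=> [|x y Ax Ay]; first by constructor 1.
have [->|x1] := hge _ Ax; first by rewrite add0r.
have [->|y1] := hge _ Ay; first by rewrite addr0.
by constructor 3; rewrite linearD [leRHS]mxE; apply: lerD x1 y1.
Qed.

(* A nonvanishing term of the Leibniz expansion has all its factors at least 1. *)
Lemma det_row_sum_ge1 n (A : 'M[int]_n) :
  (forall i j, 0 <= A i j) -> \det A != 0 -> forall i, 1 <= \sum_j A i j.
Proof.
move=> A0 dA i; apply: contrapT => /negP; rewrite -ltNge => lt1.
have /eqP : \sum_j A i j = 0.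
  by apply/eqP; rewrite eq_le sumr_ge0 // andbT; lia.
rewrite psumr_eq0 // => /allP H; case/negP: dA; apply/eqP.
rewrite /determinant big1 // => s _; rewrite (bigD1 i) //=.
by rewrite (eqP (H _ (mem_index_enum _))) mul0r mulr0.
Qed.

Lemma lform_col_mx m n (u : 'rV[R]_(m + n)) x y :
  lform u (col_mx x y) = lform (lsubmx u) x + lform (rsubmx u) y.
Proof. by rewrite /lform -{1}[u]hsubmxK mul_row_col mxE. Qed.

Lemma col_mulmx (T : pzSemiRingType) m n q j (A : 'M[T]_(m, n)) (B : 'M_(n, q)) :
  col j (A *m B) = A *m col j B.
Proof. by rewrite !colE mulmxA. Qed.

Lemma lat_height1 n (x : 'cV[int]_n) : lat R (col_mx x 1%:M) = height1 (lat R x).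
Proof. by rewrite /lat map_col_mx map_mx1. Qed.

(** The constant term [- (u *m v)], taken as a last coordinate, turns the affine inequality on [P]
    into a linear one on the cone. *)
Lemma omega_lform_ge0 n (P : set 'cV[R]_n) (u : 'rV[R]_n) v :
  (forall x, P x -> 0 <= lform u (x - v)) ->
  forall x, omega P (height1 x) -> 0 <= lform u (x - v).
Proof.
move=> Pu x; have E z : lform (row_mx u (- (u *m v))) (height1 z) = lform u (z - v).
  rewrite lform_col_mx row_mxKl row_mxKr lformB /lform mulmx1.
  by congr (_ + _); rewrite [LHS]mxE.
by rewrite -E; apply: cone_lform_ge0 => _ [z Pz <-]; rewrite E; apply: Pu.
Qed.

(** The sum of the [h i] exceeds that of the [g i] by a nonnegative combination of the edge
    directions at the vertex, on which [lsubmx u] is nonnegative by minimality. *)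
Lemma unimodular_minimizer d (P : set 'cV[R]_d) (G : set 'cV[int]_(d + 1)) v0
    (p : nat) (h : 'I_(d + 1) -> 'cV[int]_(d + 1)) :
  lattice_polytope P -> full_dimensional P -> smooth P -> vertex P (lat R v0) ->
  generates G (lat R @^-1` omega P) -> (forall g, G g -> dsubmx g = 1%:M) ->
  prime p -> (forall i, G (h i)) -> det_mod 0 h <> 0 ->
  exists g : 'I_(d + 1) -> 'cV[int]_(d + 1),
    [/\ forall i, G (g i), det_mod p g <> 0 &
        forall u : 'rV[R]_(d + 1),
          (forall x, P x -> lform (lsubmx u) (lat R v0) <= lform (lsubmx u) x) ->
          lform u (lat R (\sum_i g i)) <= lform u (lat R (\sum_i h i))].
Proof.
move=> Pl Pf Ps Pv Ggen G1 p_pr hG dh.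
have [B Bu [Pge Pnb]] := smooth_vertex Pl Pf Ps Pv.
(* [U] sends [(x, 1)] to [(v0 + B x, 1)], and the columns of [E] are the lifted vertices of the
   standard simplex; so the columns of [U *m E] are the [(v0 + col i B, 1)] and [(v0, 1)]. *)
pose U := block_mx B v0 0 1%:M : 'M[int]_(d + 1).
pose E := block_mx 1%:M 0 (const_mx 1) 1%:M : 'M[int]_(d + 1).
pose a j := col_mx (invmx B *m (usubmx (h j) - v0)) 1%:M : 'cV[int]_(d + 1).
have hE j : h j = U *m a j.
  rewrite mul_block_col mul0mx add0r !mulmx1 mulKVmx // subrK.
  by rewrite -[LHS]vsubmxK G1.
have UE : U *m E = block_mx (B + v0 *m const_mx 1) v0 (const_mx 1) 1%:M.
  by rewrite mulmx_block !mulmx1 !mulmx0 mul1mx !add0r.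
have detUE : \det (U *m E) = \det B.
  by rewrite det_mulmx det_ublock det_lblock !det1 !mulr1.
exists (fun j => col j (U *m E)); split.
- have PG x : P (lat R x) -> G (col_mx x 1%:M).
    move=> Px; apply: (height1_generator Ggen G1); last by rewrite col_mxKd.
    by rewrite /= lat_height1; apply: sub_gen_smallest; exists (lat R x).
  have c1 k : col k (const_mx 1 : 'M[int]_(1, d)) = 1%:M.
    by apply/matrixP => r s; rewrite !mxE !ord1.
  move=> j; rewrite UE block_mxEh; have [k ->|k ->] := split_ordP j.
    rewrite colKl col_col_mx c1 linearD /= col_mulmx c1 mulmx1.
    by apply: PG; rewrite latD addrC; apply: Pnb.
  by rewrite colKr col_col_mx !col_id; apply: PG; case: Pv.
(* [B] is invertible over the integers, so its determinant is 1 or -1. *)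
- rewrite (_ : det_mod p _ = (\det B %% p)%Z); last first.
    rewrite -detUE /det_mod; congr (\det _ %% _)%Z.
    by apply/matrixP => r s; rewrite !mxE.
  move/dvdz_mod0P; rewrite dvdzE; move: Bu; rewrite unitmxE.
  by case/orP=> /eqP-> /=; rewrite dvdn1 => /eqP p1; rewrite p1 in p_pr.
move=> u Hu.
(* Since [h j] is [U *m a j], the upper rows are nonnegative by the inequalities of the feasible
   cone; the last row is constantly 1. *)
pose A := \matrix_(i, j) a j i 0.
have A0 i j : 0 <= A i j.
  rewrite mxE; have [k ->|k ->] := split_ordP i; last by rewrite col_mxEd mxE !ord1.
  rewrite col_mxEu -(ler0z R).
  have := @omega_lform_ge0 _ P (row k (map_mx intr (invmx B))) (lat R v0) _
    (lat R (usubmx (h j))).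
  rewrite lform_row -latB -lat_mulmx mxE; apply.
    by move=> x Px; rewrite lform_row; apply: Pge.
  rewrite -lat_height1 -(G1 _ (hG j)) vsubmxK.
  suff : (lat R @^-1` omega P) (h j) by [].
  by rewrite -Ggen; apply: sub_gen_smallest.
have A1 : forall i, 1 <= \sum_j A i j.
  apply: det_row_sum_ge1 => //; apply: contra_not_neq dh => dA.
  rewrite /det_mod modz0.
  have -> : \matrix_(i, j) h j i 0 = U *m A.
    apply/matrixP => r s; rewrite mxE hE !mxE; apply: eq_bigr => k _.
    by rewrite [A _ _]mxE.
  by rewrite det_mulmx dA mulr0.
(* The excess of the upper row sums of [A] over those of [E], which are 1; the last row sums agree,
   both being [d + 1]. *)
pose n := \col_k (\sum_j A (lshift 1 k) j - 1).
have nE : \sum_j a j = \sum_j col j E + col_mx n 0.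
  apply/matrixP => i j; rewrite ord1 mxE !summxE {j}.
  have [k ->|k ->] := split_ordP i; rewrite ?col_mxEu ?col_mxEd.
    have -> : \sum_j col j E (lshift 1 k) 0 = 1.
      rewrite big_split_ord /= [X in _ + X]big1 => [|j _]; last first.
        by rewrite mxE block_mxEur mxE.
      rewrite (bigD1 k) //= big1 => [|j jk]; last first.
        by rewrite mxE block_mxEul mxE eq_sym (negPf jk).
      by rewrite mxE block_mxEul mxE eqxx !addr0.
    rewrite [n _ _]mxE addrC subrK.
    by apply: eq_bigr => j _; rewrite [RHS]mxE.
  rewrite [X in _ + X]mxE addr0; apply: eq_bigr => j _.
  rewrite col_mxEd [RHS]mxE; have [l ->|l ->] := split_ordP j.
    by rewrite block_mxEdl !mxE !ord1.
  by rewrite block_mxEdr !ord1.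
have -> : \sum_j h j = \sum_j col j (U *m E) + col_mx (B *m n) 0.
  rewrite (eq_bigr _ (fun j _ => hE j)) -mulmx_sumr nE mulmxDr mulmx_sumr.
  congr (_ + _); first by apply: eq_bigr => j _; rewrite col_mulmx.
  by rewrite mul_block_col !mulmx0 mul0mx !addr0.
rewrite latD lformD lerDl /lat map_col_mx map_mx0 lform_col_mx lform0 addr0.
rewrite -/(lat R _) mulmxE_lat /lform mulmx_sumr summxE sumr_ge0 // => k _.
rewrite -/(lform _ _) lformZ mulr_ge0 //.
  by rewrite mxE ler0z subr_ge0.
by have := Hu _ (Pnb k); rewrite lformD lerDl.
Qed.

End Lattice.

(** * Equality of the two Newton polyhedra *)

Theorem corollary3p10 (R : realType) (d : nat) (P : set 'cV[R]_d)
    (P_lattice : lattice_polytope P) (P_full : full_dimensional P)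
    (P_smooth : smooth P) (P_flat : G_flat P) (p : nat) (p_prime : prime p) :
  newton 0 (omega P) = newton p (omega P).
Proof.
(* In the case of the default value [set0] both unions are empty, because a family [h] has at least
   one member. *)
have : generates (hilbert_basis (omega P)) (lat R @^-1` omega P) \/
    hilbert_basis (omega P) = set0.
  by rewrite /hilbert_basis; case: xgetP => [G _ []|]; [left|right].
move: P_flat; rewrite /newton /G_flat => + [|->]; last first.
  by move=> _; rewrite !bigcup0 // => h [/(_ (rshift d ord0))].
set G := hilbert_basis _ => Gflat Ggen.
have G1 g : G g -> dsubmx g = 1%:M.
  move=> Gg; have [|x _ xg] := Gflat (lat R g); first by exists g.
  by apply: (@lat_inj R); rewrite /lat map_dsubmx -/(lat R g) -xg /height1 col_mxKd map_mx1.
(* One inclusion is immediate: a determinant that is nonzero modulo [p] is nonzero. *)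
apply/seteqP; split; apply: smallest_sub; try exact: conv_convex; last first.
  move=> z [h [hG hp] hz]; apply: sub_gen_smallest; exists h => //; split=> // h0.
  by apply: hp; move: h0; rewrite /det_mod modz0 => ->; rewrite mod0z.
move=> _ [h [hG hdet] [y yP <-]].
have [[_ [/finite_seqP[V ->] PV]] Pvl] := P_lattice.
pose N := fun b : 'cV[R]_(d + 1) => exists2 g : 'I_(d + 1) -> 'cV[int]_(d + 1),
  (forall i, G (g i)) /\ det_mod p g <> 0 & b = lat R (\sum_i g i).
(* Only the values of [b] at vertices matter; 0 is a dummy value elsewhere. *)
have /choice[b bP] v : exists b, vertex P v -> N b /\
    forall u, (forall x, P x -> lform (lsubmx u) v <= lform (lsubmx u) x) ->
      lform u b <= lform u (lat R (\sum_i h i)).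
  have [Pv|nPv] := pselect (vertex P v); last by exists 0.
  have [v0 _ v0E] := Pvl _ Pv; rewrite -v0E in Pv *.
  have [g [gG gdet gu]] :=
    unimodular_minimizer P_lattice P_full P_smooth Pv Ggen G1 p_prime hG hdet.
  by exists (lat R (\sum_i g i)) => _; split; [exists g|].
(* The same [y] is added to every [b v], so it cancels when linear forms are compared. *)
apply: (mem_convex_set (bs := [seq b v + y | v <- V & `[< vertex P v >]])).
- exact: conv_convex.
- move=> _ /= /mapP[v + ->]; rewrite mem_filter => /andP[/asboolP Pv _].
  apply: sub_gen_smallest; have [[g gG ->] _] := bP _ Pv.
  by exists g => //; exists y.
(* An empty [V] would make the affine hull of [P] empty. *)
move=> u; have [x0 x0V] : exists x, x \in V.
  apply: contrapT => V0.
  suff /(_ 0 Logic.I) : setT `<=` (set0 : set 'cV[R]_d) by [].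
  rewrite -P_full PV; apply: smallest_sub => //; apply: smallest_sub.
    by apply/convex_setP.
  by move=> x /= xV; apply: V0; exists x.
have [v [Pv vmin]] := vertex_minimizer (lsubmx u) x0V.
have vV := vertex_mem Pv; rewrite -PV in Pv vmin.
exists (b v + y); first by apply/map_f; rewrite mem_filter vV andbT; apply/asboolP.
by rewrite !lformD lerD2r; have [_] := bP _ Pv; apply.
Qed.
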